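(* There are finite induced subgraphs of $\Gamma$ with density greater than $3.50074529$. More precisely, let $$D_+=\frac72+\frac{\omega+q_3+p_0+2q_2}{2(1-\rho-3q_3-3p_0-2q_2)},$$ where, with $s=\sqrt3$ and $j=\tfrac12\bigl(\sqrt3-\sqrt{2\sqrt3-1}\bigr)$, $$\omega=\frac{120197s-207644}{455008},\qquad \rho=\frac{1410649978-795527183s}{6469758752},\qquad q_3=\frac{24789s-42440}{1820032},$$ $$q_2=\frac{140462279622-81074695963s}{414064560128}\,j,\qquad p_0=\frac{518-299s}{131072}.$$ Then $$\operatorname{dens}(\Gamma)\ge D_+,\qquad 3.5007452936557<D_+<3.5007452936559.$$ In particular, $h_E(\Gamma)<0.49925471$.
   Context: $F$ is Thompson's group, $F=\langle x_0,x_1,x_2,\dots\mid x_i^{-1}x_jx_i=x_{j+1}\ (i<j)\rangle$, generated by $x_0,x_1$. $\Gamma$ is the undirected Cayley graph of $F$ with respect to the standard generating set $\{x_0,x_1\}$. For a nonempty finite set $Y\subset F$, $E(Y)$ is the set of undirected edges of $\Gamma$ with both endpoints in $Y$, and $\partial_E Y$ is the undirected edge boundary (edges with exactly one endpoint in $Y$). The density of $Y$ (equivalently of the subgraph induced by $Y$) is $\operatorname{dens}(Y)=2|E(Y)|/|Y|$, and $\operatorname{dens}(\Gamma)=\sup\{\operatorname{dens}(Y):\varnothing\ne Y\subset F\text{ finite}\}$. The edge-isoperimetric constant is $h_E(\Gamma)=\inf\{|\partial_EY|/|Y|:\varnothing\ne Y\subset F\text{ finite}\}$. *)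

(* Defs.v *)
From HB Require Import structures.
From mathcomp Require Import all_boot all_order all_algebra.
From mathcomp Require Import generic_quotient finmap.
From mathcomp Require Import all_classical all_reals.

Set Implicit Arguments.
Unset Strict Implicit.
Unset Printing Implicit Defensive.

Import Order.TTheory GRing.Theory Num.Theory.

Local Open Scope quotient_scope.
Local Open Scope fset_scope.
Local Open Scope classical_set_scope.
Local Open Scope ring_scope.

(* Thompson's group F, as the group presented by generators x_0, x_1, ...     *)
(* and relations x_i^-1 x_j x_i = x_(j+1) for i < j: words modulo the         *)
(* congruence generated by free cancellation and the relations.               *)

(* The letter (i, false) stands for x_i and (i, true) for x_i^-1. *)
Definition word : Type := seq (nat * bool).

Definition letter_inv (a : nat * bool) : nat * bool := (a.1, ~~ a.2).

Definition word_inv (u : word) : word := rev (map letter_inv u).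

Inductive thompson_eqv : word -> word -> Prop :=
| thompson_refl u : thompson_eqv u u
| thompson_sym u v : thompson_eqv u v -> thompson_eqv v u
| thompson_trans v u w :
    thompson_eqv u v -> thompson_eqv v w -> thompson_eqv u w
| thompson_cat u u' v v' : thompson_eqv u u' -> thompson_eqv v v' ->
    thompson_eqv (u ++ v) (u' ++ v')
| thompson_cancel a : thompson_eqv [:: a; letter_inv a] [::]
| thompson_rel (i j : nat) : (i < j)%N ->
    thompson_eqv [:: (i, true); (j, false); (i, false)] [:: (j.+1, false)].

Definition thompson_eqvb (u v : word) : bool := `[< thompson_eqv u v >].

Lemma thompson_eqvb_refl : reflexive thompson_eqvb.
Proof. by move=> u; apply/asboolP; exact: thompson_refl. Qed.

Lemma thompson_eqvb_sym : symmetric thompson_eqvb.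
Proof. by move=> u v; apply/asboolP/asboolP; exact: thompson_sym. Qed.

Lemma thompson_eqvb_trans : transitive thompson_eqvb.
Proof.
by move=> v u w /asboolP uv /asboolP vw; apply/asboolP; exact: thompson_trans vw.
Qed.

Canonical thompson_equiv := EquivRel thompson_eqvb
  thompson_eqvb_refl thompson_eqvb_sym thompson_eqvb_trans.

Definition F : Type := {eq_quot thompson_eqvb}.
HB.instance Definition _ := Choice.on F.
HB.instance Definition _ := Quotient.on F.
HB.instance Definition _ := EqQuotient.on F.

Lemma F_eqP (u v : word) : \pi_F u = \pi_F v <-> thompson_eqv u v.
Proof.
split=> [/eqP|uv].
  by rewrite piE => /asboolP.
by apply/eqP; rewrite piE; apply/asboolP.
Qed.

Definition F_one : F := \pi_F [::].
Definition F_mul (g h : F) : F := \pi_F (repr g ++ repr h).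
Definition F_inv (g : F) : F := \pi_F (word_inv (repr g)).

Lemma thompson_repr (u : word) : thompson_eqv (repr (\pi_F u)) u.
Proof. by apply/F_eqP; rewrite reprK. Qed.

Lemma F_mul_pi (u v : word) : F_mul (\pi_F u) (\pi_F v) = \pi_F (u ++ v).
Proof. by apply/F_eqP; apply: thompson_cat; exact: thompson_repr. Qed.

Lemma letter_invK : involutive letter_inv.
Proof. by case=> i b; rewrite /letter_inv /= negbK. Qed.

Lemma word_invK : involutive word_inv.
Proof.
by move=> u; rewrite /word_inv map_rev revK -map_comp map_id_in // => a _ /=;
  exact: letter_invK.
Qed.

Lemma cat_word_inv (u : word) : thompson_eqv (u ++ word_inv u) [::].
Proof.
elim: u => [|a u IHu]; first exact: thompson_refl.
have -> : (a :: u) ++ word_inv (a :: u) =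
    [:: a] ++ ((u ++ word_inv u) ++ [:: letter_inv a]).
  by rewrite /word_inv /= rev_cons -cats1 catA.
apply: (@thompson_trans ([:: a] ++ ([::] ++ [:: letter_inv a]))).
  apply: thompson_cat; first exact: thompson_refl.
  by apply: thompson_cat IHu _; exact: thompson_refl.
exact: thompson_cancel.
Qed.

Lemma F_mulA : associative F_mul.
Proof.
elim/quotW=> u; elim/quotW=> v; elim/quotW=> w.
by rewrite (F_mul_pi v) (F_mul_pi u) (F_mul_pi u v) (F_mul_pi (u ++ v)) catA.
Qed.

Lemma F_mul1g : left_id F_one F_mul.
Proof. by move=> g; rewrite -[g]reprK F_mul_pi. Qed.

Lemma F_mulg1 : right_id F_one F_mul.
Proof. by move=> g; rewrite -[g]reprK F_mul_pi cats0. Qed.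

Lemma F_mulgV : right_inverse F_one F_inv F_mul.
Proof.
by move=> g; rewrite -{1}[g]reprK F_mul_pi; apply/F_eqP; exact: cat_word_inv.
Qed.

Lemma F_mulVg : left_inverse F_one F_inv F_mul.
Proof.
move=> g; rewrite -{2}[g]reprK F_mul_pi; apply/F_eqP.
by rewrite -{2}[repr g]word_invK; exact: cat_word_inv.
Qed.

HB.instance Definition _ :=
  isGroup.Build F F_mulA F_mul1g F_mulg1 F_mulVg F_mulgV.

Definition F_gen (i : nat) : F := \pi_F [:: (i, false)].

Lemma F_inv_pi (u : word) : F_inv (\pi_F u) = \pi_F (word_inv u).
Proof.
have mulVu : F_mul (\pi_F (word_inv u)) (\pi_F u) = F_one.
  rewrite F_mul_pi; apply/F_eqP.
  by rewrite -{2}[u]word_invK; exact: cat_word_inv.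
by rewrite -[RHS]F_mulg1 -(F_mulgV (\pi_F u)) F_mulA mulVu F_mul1g.
Qed.

Lemma F_gen_rel (i j : nat) : (i < j)%N ->
  ((F_gen i)^-1 * F_gen j * F_gen i)%g = F_gen j.+1.
Proof.
move=> ij.
change (F_mul (F_mul (F_inv (F_gen i)) (F_gen j)) (F_gen i) = F_gen j.+1).
rewrite /F_gen F_inv_pi (F_mul_pi [:: (i, true)]).
rewrite (F_mul_pi [:: (i, true); (j, false)]).
by apply/F_eqP; exact: thompson_rel.
Qed.

(* The edge {g, h} of the undirected Cayley graph of G with respect to S is   *)
(* present when h = g s or g = h s for some s in S, with g and h distinct.    *)
Definition cayley_adj (G : groupType) (S : {fset G}) : rel G :=
  fun g h => (g != h) && ((g^-1 * h \in S) || (h^-1 * g \in S))%g.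

Definition cayley_edge (G : groupType) (S : {fset G}) (e : {fset G}) : Prop :=
  exists g h : G, cayley_adj S g h /\ e = [fset g; h].

(* E(Y) and the edge boundary; fset_set is only meaningful on finite sets,    *)
(* see finite_edges_in and finite_edge_boundary.                              *)
Definition edges_in (G : groupType) (S Y : {fset G}) : {fset {fset G}} :=
  fset_set [set e | cayley_edge S e /\ (e `<=` Y)%fset].

Definition edge_boundary (G : groupType) (S Y : {fset G}) : {fset {fset G}} :=
  fset_set [set e | cayley_edge S e /\ #|` (e `&` Y)%fset| = 1%N].

Lemma cayley_edge_meet (G : groupType) (S Y e : {fset G}) :
  cayley_edge S e -> (0 < #|` (e `&` Y)%fset|)%N ->
  exists2 g, g \in Y & exists2 s, s \in S &
    e = [fset g; (g * s)%g] \/ e = [fset g; (g * s^-1)%g].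
Proof.
move=> [g [h [/andP[_ adj] ->]]]; rewrite cardfs_gt0 => /fset0Pn[x].
rewrite !inE => /andP[/orP[] /eqP -> xY].
- exists g => //; case/orP: adj => sS.
  + by exists (g^-1 * h)%g => //; left; rewrite mulVKg.
  + by exists (h^-1 * g)%g => //; right; rewrite invgM invgK mulVKg.
- exists h => //; rewrite fsetUC; case/orP: adj => sS.
  + by exists (g^-1 * h)%g => //; right; rewrite invgM invgK mulVKg.
  + by exists (h^-1 * g)%g => //; left; rewrite mulVKg.
Qed.

Lemma finite_cayley_edge_meet (G : groupType) (S Y : {fset G}) :
  finite_set [set e | cayley_edge S e /\ (0 < #|` (e `&` Y)%fset|)%N].
Proof.
pose B := ([fset [fset g; (g * s)%g] | g in Y, s in S] `|`
  [fset [fset g; (g * s^-1)%g] | g in Y, s in S])%fset.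
apply: sub_finite_set (finite_fset B) => e /= [ed me].
have [g gY [s sS eE]] := cayley_edge_meet ed me.
rewrite inE; apply/orP; case: eE => ->; [left|right];
  by apply/imfset2P; exists g => //; exists s.
Qed.

Lemma finite_edge_boundary (G : groupType) (S Y : {fset G}) :
  finite_set [set e | cayley_edge S e /\ #|` (e `&` Y)%fset| = 1%N].
Proof.
by apply: sub_finite_set (finite_cayley_edge_meet S Y) => e /= [? ->].
Qed.

Lemma finite_edges_in (G : groupType) (S Y : {fset G}) :
  finite_set [set e | cayley_edge S e /\ (e `<=` Y)%fset].
Proof.
apply: sub_finite_set (finite_cayley_edge_meet S Y) => e /= [ed /fsetIidPl ->].
split=> //; case: ed => g [h [_ ->]]; rewrite cardfs_gt0; apply/fset0Pn.
by exists g; rewrite !inE eqxx.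
Qed.

Definition dens (R : realType) (G : groupType) (S Y : {fset G}) : R :=
  2 * #|` edges_in S Y|%:R / #|` Y|%:R.

Definition dens_graph (R : realType) (G : groupType) (S : {fset G}) : R :=
  sup [set dens R S Y | Y in [set Y : {fset G} | Y != fset0]].

Definition edge_isoperimetric (R : realType) (G : groupType)
    (S : {fset G}) : R :=
  inf [set #|` edge_boundary S Y|%:R / #|` Y|%:R
        | Y in [set Y : {fset G} | Y != fset0]].

Lemma card_edges_in (G : groupType) (S Y : {fset G}) :
  (#|` edges_in S Y| <= #|` Y| * #|` S|)%N.
Proof.
rewrite -(size_allpairs (fun g s => [fset g; (g * s)%g])).
apply: uniq_leq_size (fset_uniq _) _ => e.
rewrite in_fset_set; last exact: finite_edges_in.
rewrite inE /= => -[[g [h [/andP[_ adj] ->]]] /fsubsetP eY].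
have gY : g \in Y by apply: eY; rewrite !inE eqxx.
have hY : h \in Y by apply: eY; rewrite !inE eqxx orbT.
apply/allpairsP; case/orP: adj => sS.
- by exists (g, g^-1 * h)%g; split; rewrite //= mulVKg.
- by exists (h, h^-1 * g)%g; split; rewrite //= mulVKg fsetUC.
Qed.

(* The supremum and infimum above are those of nonempty bounded sets, never   *)
(* the default values of sup and inf.                                         *)
Lemma has_sup_dens (R : realType) (G : groupType) (S : {fset G}) :
  has_sup [set dens R S Y | Y in [set Y : {fset G} | Y != fset0]].
Proof.
split.
  exists (dens R S [fset 1%g]), [fset 1%g] => //=.
  by apply/fset0Pn; exists 1%g; rewrite inE.
exists (2 * #|` S|%:R) => _ [Y /= Y0 <-].
rewrite /dens -mulrA ler_pM2l ?ltr0n // ler_pdivrMr ?ltr0n ?cardfs_gt0 //.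
by rewrite -natrM ler_nat mulnC card_edges_in.
Qed.

Lemma has_inf_edge_isoperimetric (R : realType) (G : groupType)
    (S : {fset G}) :
  has_inf [set (#|` edge_boundary S Y|%:R / #|` Y|%:R : R)
            | Y in [set Y : {fset G} | Y != fset0]].
Proof.
split.
  by eexists; exists [fset 1%g] => //=; apply/fset0Pn; exists 1%g; rewrite inE.
by exists 0 => _ [Y /= _ <-]; rewrite divr_ge0.
Qed.

Definition F_gens : {fset F} := [fset F_gen 0%N; F_gen 1%N].

(* Large literals need the %:R: a bare numeral of ring_scope is expanded in   *)
(* unary.                                                                     *)
Section Constants.
Variable R : realType.

Local Notation s := (Num.sqrt 3 : R).

Definition jconst : R := (s - Num.sqrt (2 * s - 1)) / 2.

Definition omega : R := (120197%:R * s - 207644%:R) / 455008%:R.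

Definition rho : R := (1410649978%:R - 795527183%:R * s) / 6469758752%:R.

Definition q3 : R := (24789%:R * s - 42440%:R) / 1820032%:R.

Definition q2 : R :=
  (140462279622%:R - 81074695963%:R * s) / 414064560128%:R * jconst.

Definition p0 : R := (518%:R - 299%:R * s) / 131072%:R.

Definition Dplus : R := 7 / 2 +
  (omega + q3 + p0 + 2 * q2) / (2 * (1 - rho - 3 * q3 - 3 * p0 - 2 * q2)).

End Constants.

(* Main.v *)
Require Import Defs.
From HB Require Import structures.
From mathcomp Require Import all_boot all_order all_algebra.
From mathcomp Require Import generic_quotient finmap.
From mathcomp Require Import all_classical all_reals.
From mathcomp Require Import ring lra zify.

(** Reading a finite sequence of binary trees as a forest embeds the positive
elements of F: the generator x_i adds a caret joining the trees number i and
i+1, the product stacks forests.  Tree number 0 being a left comb, an element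
x_0^a * (forest) is a forest with a pointer to its tree number a; left
multiplication by x_0 moves the pointer one tree to the right, and left
multiplication by x_1 joins the pointed tree to the next one.  Taking inverses
turns this into the right Cayley graph (lemmas [vertex_x0], [vertex_x1]).

By layer-cake summation ([coarea]) it is enough to find a finitely supported
nonnegative function f on the group for which the sum over the edges of the
smaller of the two end values is large compared with the sum of f; a function
may be pushed forward from pointed forests without knowing that distinct
forests give distinct elements.  Let all the trees of the forest come from a
finite set closed under subtrees, with multiplicative weights of sum 1, so that
the trees are independent random variables.  Far from the ends of the sequence
every state has both its x_0-edges, while its forest is obtained from another
one by joining two trees exactly when the pointed tree is not a single leaf.
If p is the weight of the leaf this makes 2 - p edges per state, and p can be
pushed down to 1/4 but not further: this is the density 7/2.

To exceed 7/2, choose the set of trees so that those of a subset H can never be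
joined to a leaf, on either side.  In a stretch Leaf, H, Leaf, H of the forest the
three states that point to the first three trees meet only five edges: the four
x_0-edges, and the one splitting the first H.  Deleting three vertices with five
edges raises a density close to 7/2, since 2 * 5 / 3 < 7 / 2.  Stretches may
overlap, so f is decreased by 1/2 for each stretch that covers the pointer;
then all counts are linear in the probability (p eta)^2 of a stretch, where eta
is the total weight of H ([dense_subgraph]).

The family takes all trees of height at most k, and then adds three more layers
of carets in which leaves may only be joined to trees of height at most k.  The
trees of these layers are the set H.  For large k the weights can be normalised
with p arbitrarily close to 1/4 ([critical_family]), and then eta >= 0.235, which
gives a density above 3.500746 ([dense_F]).  As D_+ = 3.50074529..., this one
subgraph yields the density bounds, and the isoperimetric bound follows because
the edge boundary has at most 4|Y| - 2|E(Y)| elements. *)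

Set Implicit Arguments.
Unset Strict Implicit.
Unset Printing Implicit Defensive.

Import Order.TTheory GRing.Theory Num.Theory.

Local Open Scope quotient_scope.
Local Open Scope fset_scope.
Local Open Scope ring_scope.

(** * Cayley graphs: counting edges by their labels *)

(** Edges are counted by starting point and generator, rather than as two-element
sets, so that the count is a sum over generators. *)
Definition labelled_edges (G : groupType) (S Y : {fset G}) : nat :=
  (\sum_(s <- S) #|` [fset g in Y | (g * s)%g \in Y]|)%N.

(** Two labelled edges with the same ends force a generator to be trivial or two
generators to be inverse to each other. *)
Lemma labelled_edges_le (G : groupType) (S Y : {fset G}) :
  {in S, forall s, s != 1%g} -> {in S &, forall s t, (s * t)%g != 1%g} ->
  (labelled_edges S Y <= #|` edges_in S Y|)%N.
Proof.
move=> S1 SS; pose Z s := [fset g in Y | (g * s)%g \in Y].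
have -> : labelled_edges S Y =
    size [seq [fset g; (g * s)%g] | s <- S, g <- Z s].
  by rewrite size_allpairs_dep sumnE big_map.
apply: uniq_leq_size => [|e /allpairsPdep[s [g [sS]]]].
  apply: allpairs_uniq_dep => [|s _|]; rewrite ?fset_uniq //.
  move=> [s g] [t h] /allpairsPdep[s' [g' [sS _ [? ?]]]].
  move=> /allpairsPdep[t' [h' [tS _ [? ?]]]] /= eE; subst s' t' g' h'.
  have gt : g \in [fset h; (h * t)%g] by rewrite -eE !inE eqxx.
  have ht : h \in [fset g; (g * s)%g] by rewrite eE !inE eqxx.
  have gst : (g * s)%g \in [fset h; (h * t)%g] by rewrite -eE !inE eqxx orbT.
  move: gt; rewrite !inE => /orP[/eqP gh|/eqP ghs].
    subst h; move: gst; rewrite !inE => /orP[|/eqP/mulgI-> //].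
    by rewrite -{2}[g]mulg1 => /eqP/mulgI/eqP; rewrite (negbTE (S1 s sS)).
  move: ht; rewrite !inE => /orP[|] /eqP hE; move: ghs; rewrite hE.
    by rewrite -{1}[g]mulg1 => /mulgI/esym/eqP; rewrite (negbTE (S1 t tS)).
  rewrite -{1}[g]mulg1 -mulgA => /mulgI/esym/eqP.
  by rewrite (negbTE (SS s t sS tS)).
rewrite !inE => /andP[gY gsY] ->; rewrite in_fset_set; last first.
  exact: finite_edges_in.
rewrite inE /=; split.
  exists g, (g * s)%g; split=> //; rewrite /cayley_adj mulKg sS andbT.
  rewrite -{1}[g]mulg1; apply/negP => /eqP/mulgI/esym/eqP.
  by rewrite (negbTE (S1 s sS)).
by apply/fsubsetP => x; rewrite !inE => /orP[] /eqP ->.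
Qed.

(** Each point of Y has an outgoing and an incoming edge for each generator, and
a labelled edge inside Y takes up one of each kind; what remains contains the
boundary. *)
Lemma edge_boundary_le (G : groupType) (S Y : {fset G}) :
  (#|` edge_boundary S Y| + 2 * labelled_edges S Y <= 2 * (#|` S| * #|` Y|))%N.
Proof.
pose In s := [fset g in Y | (g * s)%g \in Y].
pose Out s := [fset g in Y | (g * s)%g \notin Y].
have InOut s : (#|` In s| + #|` Out s| = #|` Y|)%N.
  rewrite -[in RHS](cardfsID (In s) Y); congr (_ + _)%N; congr #|` _|.
    by apply/fsetP => g; rewrite !inE; case: (g \in Y).
  by apply/fsetP => g; rewrite !inE; case: (g \in Y); rewrite ?andbT ?andbF.
have InV s : (#|` In s| <= #|` In s^-1%g|)%N.
  have <- : #|` [fset (g * s)%g | g in In s]| = #|` In s|.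
    by rewrite card_imfset //; exact: mulIg.
  apply: fsubset_leq_card; apply/fsubsetP => _ /imfsetP[g /= gI ->].
  by move: gI; rewrite !inE mulgK => /andP[-> ->].
pose out := [seq [fset g; (g * s)%g] | s <- S, g <- Out s] ++
  [seq [fset g; (g * s^-1)%g] | s <- S, g <- Out s^-1%g].
have bnd : (#|` edge_boundary S Y| <= size out)%N.
  apply: uniq_leq_size (fset_uniq _) _ => e.
  rewrite in_fset_set; last exact: finite_edge_boundary.
  rewrite inE /= => -[ed e1].
  have out2 g h : g \in Y -> e = [fset g; h] -> h != g -> h \notin Y.
    move=> gY eE hg; apply/negP => hY; move: e1; rewrite eE.
    rewrite (fsetIidPl _) ?cardfs2 ?[g == h]eq_sym ?hg //.
    by apply/fsubsetP => x; rewrite !inE => /orP[] /eqP ->.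
  have ne g h : e = [fset g; h] -> h != g.
    case: ed => u [v [/andP[uv _] ->]] E; apply/negP => /eqP hg.
    have := congr1 (fun x : {fset G} => #|` x|) E.
    by rewrite hg !cardfs2 uv eqxx.
  have [] := @cayley_edge_meet G S Y e ed; first by rewrite e1.
  move=> g gY [s sS [] eE]; rewrite mem_cat; apply/orP; [left|right];
    apply/allpairsPdep; exists s, g; split; rewrite // !inE gY /=;
    by apply: (out2 g) => //; apply: ne.
apply: (@leq_trans (size out + 2 * labelled_edges S Y));
  first by rewrite leq_add2r.
rewrite size_cat !size_allpairs_dep !sumnE !big_map /labelled_edges.
rewrite -big_split big_distrr -big_split /= mulnCA.
apply: (@leq_trans (\sum_(s <- S) 2 * #|` Y|)%N); last first.
  by rewrite big_const_seq count_predT iter_addn_0 mulnC.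
apply: leq_sum => s _; have := InOut s; have := InOut s^-1%g; have := InV s.
rewrite -/(In s) -/(Out s) -/(Out s^-1%g) /= => H1 H2 H3.
move: #|` In s| #|` Out s| #|` In s^-1%g| #|` Out s^-1%g| #|` Y| H1 H2 H3 => *.
lia.
Qed.

(** The superlevel sets of f satisfy the bound, and integrating it over the
level gives the claim.  Level by level: subtracting the minimum m of f over its
support Y lowers the left side by m times the number of edges inside Y. *)
Lemma coarea (R : realDomainType) (G : groupType) (S : {fset G}) (d : R) :
  (forall Y : {fset G}, Y != fset0 ->
    (labelled_edges S Y)%:R <= d * #|` Y|%:R) ->
  forall (Y : {fset G}) (f : G -> R), (forall g, 0 <= f g) ->
    (forall g, g \notin Y -> f g = 0) ->
  \sum_(s <- S) \sum_(g <- Y) Num.min (f g) (f (g * s)%g)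
    <= d * \sum_(g <- Y) f g.
Proof.
move=> ub Y; move En : #|` Y| => n; elim: n Y En => [|n IHn] Y Yn f f0 fY.
  move/cardfs0_eq: Yn => ->; rewrite big_seq_fset0 mulr0 big1 // => s _.
  by rewrite big_seq_fset0.
have /fset0Pn[g1 g1Y] : Y != fset0 by rewrite -cardfs_gt0 Yn.
have [g0 g0Y g0min] : exists2 g0, g0 \in Y & {in Y, forall g, f g0 <= f g}.
  case: (@arg_minP _ R Y [` g1Y] xpredT (fun g => f (val g)) isT).
  move=> g0 _ g0min; exists (val g0) => [|g gY]; first exact: valP.
  exact: (g0min [` gY] isT).
set m := f g0 in g0min.
pose f' g := f g - (if g \in Y then m else 0).
have f'0 g : 0 <= f' g.
  by rewrite /f'; case: ifP => gY; rewrite ?subr0 // subr_ge0 g0min.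
have f'Y g : g \notin Y `\ g0 -> f' g = 0.
  rewrite !inE negb_and negbK /f' => /orP[/eqP->|gY].
    by rewrite g0Y subrr.
  by rewrite (negbTE gY) fY // subrr.
have card' : #|` Y `\ g0| = n.
  by apply/eqP; rewrite -eqSS -Yn (cardfsD1 g0 Y) g0Y.
have := IHn (Y `\ g0) card' f' f'0 f'Y.
have fE : \sum_(g <- Y) f g = m * #|` Y|%:R + \sum_(g <- Y `\ g0) f' g.
  rewrite (big_fsetD1 g0 g0Y) /= -/m (cardfsD1 g0 Y) g0Y.
  rewrite natrD mulrDr mulr1 -addrA; congr (_ + _).
  rewrite -sum1_size natr_sum mulr_sumr -big_split /=.
  rewrite big_seq [RHS]big_seq; apply: eq_bigr => g.
  rewrite !inE => /andP[_ gY].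
  by rewrite /f' gY mulr1 addrC subrK.
have sE s : \sum_(g <- Y) Num.min (f g) (f (g * s)%g) =
    m * #|` [fset g in Y | (g * s)%g \in Y]|%:R +
    \sum_(g <- Y `\ g0) Num.min (f' g) (f' (g * s)%g).
  have -> : \sum_(g <- Y `\ g0) Num.min (f' g) (f' (g * s)%g) =
      \sum_(g <- Y) Num.min (f' g) (f' (g * s)%g).
    rewrite (big_fsetD1 g0 g0Y) /= [X in X + _](_ : _ = 0) ?add0r //.
    by rewrite f'Y ?min_l // !inE eqxx.
  rewrite -sum1_size natr_sum mulr_sumr -big_fset_condE /=.
  rewrite [X in _ = X + _]big_mkcond /=.
  rewrite -big_split /= big_seq [RHS]big_seq; apply: eq_bigr => g gY.
  rewrite /f' gY; case: ifP => gsY.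
    by rewrite mulr1 addr_minr ![m + _]addrC !subrK.
  by rewrite add0r subr0 [f (g * s)%g]fY ?gsY // !min_r // subr_ge0 g0min.
move=> IH; rewrite (eq_bigr _ (fun s _ => sE s)).
rewrite big_split /= fE mulrDr; apply: lerD => //.
rewrite -mulr_sumr -natr_sum mulrCA; apply: ler_wpM2l; first exact: f0.
by apply: ub; apply/fset0Pn; exists g0.
Qed.

(** * Forests as elements of Thompson's group *)

(** The homomorphism from F to the integers with x_0 of degree 1 and every other
generator of degree 2; positivity of these degrees and their difference are all
that is used to tell elements of F apart. *)
Definition word_degree (u : word) : int :=
  \sum_(a <- u) (-1) ^+ a.2 * (if a.1 == 0%N then 1 else 2).

Lemma word_degree_eqv (u v : word) :
  thompson_eqv u v -> word_degree u = word_degree v.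
Proof.
rewrite /word_degree.
elim=> // [v' u' w _ -> _ -> //|u1 u2 v1 v2 _ Hu _ Hv|[i b]|i j ij].
- by rewrite !big_cat /= Hu Hv.
- by rewrite !big_cons !big_nil /=; case: b; case: (i == _).
- by rewrite !big_cons !big_nil /= -(prednK (leq_ltn_trans (leq0n i) ij)) /=;
    case: (i == _).
Qed.

Lemma F_gens_neq1 : {in F_gens, forall s, s != 1%g}.
Proof.
move=> s; rewrite !inE => /orP[] /eqP ->; apply/negP => /eqP/F_eqP;
  by move/word_degree_eqv; rewrite /word_degree !big_cons !big_nil.
Qed.

Lemma F_gens_mul_neq1 : {in F_gens &, forall s t, (s * t)%g != 1%g}.
Proof.
have pos i j : (F_gen i * F_gen j)%g != 1%g.
  have -> : (F_gen i * F_gen j)%g = \pi_F [:: (i, false); (j, false)].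
    exact: F_mul_pi.
  apply/negP => /eqP/F_eqP/word_degree_eqv.
  by rewrite /word_degree !big_cons !big_nil /=;
    case: (i == _); case: (j == _).
by move=> s t; rewrite !inE => /orP[] /eqP -> /orP[] /eqP ->.
Qed.

Lemma F_gen01 : F_gen 0%N != F_gen 1%N.
Proof.
apply/negP => /eqP/F_eqP/word_degree_eqv.
by rewrite /word_degree !big_cons !big_nil.
Qed.

Inductive tree : Type := Leaf | Node of tree & tree.

HB.instance Definition _ := gen_eqMixin tree.

(** The positive element that joins the leaves i, i+1, ... into the tree T.  It
acts from right to left: A is built first, after which the leaves of B are
numbered from i+1. *)
Fixpoint tree_elt (i : nat) (T : tree) : F :=
  if T is Node A B then (F_gen i * tree_elt i.+1 B * tree_elt i A)%g else 1%g.

Fixpoint forest_elt (i : nat) (t : seq tree) : F :=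
  if t is T :: t' then (forest_elt i.+1 t' * tree_elt i T)%g else 1%g.

Lemma F_gen_swap (i j : nat) : (i < j)%N ->
  (F_gen j * F_gen i = F_gen i * F_gen j.+1)%g.
Proof. by move=> ij; rewrite -(F_gen_rel ij) -!mulgA mulVKg. Qed.

(** Joining two trees on the left of T renumbers the leaves of T. *)
Lemma tree_elt_shift (j i : nat) (T : tree) : (j < i)%N ->
  (F_gen j * tree_elt i.+1 T = tree_elt i T * F_gen j)%g.
Proof.
elim: T i => [|A IHA B IHB] i ji /=; first by rewrite mulg1 mul1g.
rewrite !mulgA -(F_gen_swap ji) -[in LHS]mulgA -[in LHS]mulgA.
rewrite [(F_gen j * (_ * _))%g]mulgA IHB ?ltnS ?(ltnW ji) //.
by rewrite -!mulgA IHA.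
Qed.

Lemma forest_elt_shift (j i : nat) (t : seq tree) : (j < i)%N ->
  (F_gen j * forest_elt i.+1 t = forest_elt i t * F_gen j)%g.
Proof.
elim: t i => [|T t IHt] i ji /=; first by rewrite mulg1 mul1g.
by rewrite mulgA IHt ?ltnS ?(ltnW ji) // -!mulgA tree_elt_shift.
Qed.

Lemma forest_elt_cat (i : nat) (s t : seq tree) :
  forest_elt i (s ++ t) = (forest_elt (size s + i) t * forest_elt i s)%g.
Proof.
elim: s i => [|T s IHs] i /=; first by rewrite mulg1.
by rewrite IHs mulgA addSnnS.
Qed.

Lemma forest_elt_Node (i : nat) (A B : tree) (t : seq tree) :
  forest_elt i (Node A B :: t) = (F_gen i * forest_elt i (A :: B :: t))%g.
Proof. by rewrite /= !mulgA forest_elt_shift. Qed.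

(** The inverse is there because the carets are added by left multiplication,
while the edges of the Cayley graph are right multiplications. *)
Definition vertex (a : nat) (t : seq tree) : F :=
  ((F_gen 0 ^+ a * forest_elt 1 t)^-1)%g.

Lemma vertex_x0 (a : nat) (t : seq tree) :
  (vertex a.+1 t * F_gen 0)%g = vertex a t.
Proof. by rewrite /vertex expgS -mulgA invgM mulgVK. Qed.

Lemma F_gen1_expx0 (a : nat) :
  (F_gen 1 * F_gen 0 ^+ a = F_gen 0 ^+ a * F_gen a.+1)%g.
Proof.
elim: a => [|a IHa]; first by rewrite mulg1 mul1g.
by rewrite expgSr mulgA IHa -mulgA F_gen_swap // mulgA.
Qed.

Lemma vertex_x1 (s : seq tree) (A B : tree) (t : seq tree) :
  (vertex (size s) (s ++ Node A B :: t) * F_gen 1)%g =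
    vertex (size s) (s ++ A :: B :: t).
Proof.
rewrite /vertex !forest_elt_cat forest_elt_Node addn1 -mulgA.
by rewrite [X in (X^-1 * _)%g]mulgA -F_gen1_expx0 -mulgA invgM mulgVK.
Qed.

(** * Independent random trees *)

Lemma sum_subset (V : nmodType) (I : eqType) (r s : seq I) (f : I -> V) :
  uniq r -> uniq s -> {subset r <= s} ->
  \sum_(i <- s) f i = \sum_(i <- r) f i + \sum_(i <- s | i \notin r) f i.
Proof.
move=> ur us rs; rewrite (bigID (mem r)) /=; congr (_ + _).
rewrite -[LHS]big_filter; apply: perm_big; apply: uniq_perm => //.
  exact: filter_uniq.
by move=> i; rewrite mem_filter; case: (boolP (i \in r)) => // /rs ->.
Qed.

Lemma ler_sum_subset (R : numDomainType) (I : eqType) (r s : seq I)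
    (f : I -> R) : uniq r -> uniq s -> {subset r <= s} ->
  (forall i, 0 <= f i) -> \sum_(i <- r) f i <= \sum_(i <- s) f i.
Proof.
by move=> ur us rs f0; rewrite (sum_subset f ur us rs) lerDl sumr_ge0.
Qed.

Section SquareSums.
Variables (R : numDomainType) (G : nat -> nat -> R) (M : nat).
Hypothesis G_ge0 : forall a b, 0 <= G a b.

(** The two ends of an edge range over two different corners of the square of
index pairs. *)
Lemma square_sum_lower : \sum_(a < M) \sum_(b < M) G a b <=
  \sum_(a < M.+1) \sum_(b < M.+1) G a b.
Proof.
rewrite [leRHS]big_ord_recr -[leLHS]addr0 /=; apply: lerD; last exact: sumr_ge0.
by apply: ler_sum => a _; rewrite big_ord_recr /= lerDl.
Qed.

Lemma square_sum_left : \sum_(a < M) \sum_(b < M) G a.+1 b <=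
  \sum_(a < M.+1) \sum_(b < M.+1) G a b.
Proof.
rewrite [leRHS]big_ord_recl -[leLHS]add0r /=; apply: lerD.
  exact: sumr_ge0.
by apply: ler_sum => a _; rewrite big_ord_recr /= lerDl.
Qed.

Lemma square_sum_right : \sum_(a < M) \sum_(b < M) G a b.+1 <=
  \sum_(a < M.+1) \sum_(b < M.+1) G a b.
Proof.
rewrite [leRHS]big_ord_recr -[leLHS]addr0 /=; apply: lerD; last exact: sumr_ge0.
by apply: ler_sum => a _; rewrite big_ord_recl /= lerDr.
Qed.

End SquareSums.

Section Expectation.
Variables (R : realFieldType) (I : eqType) (ts : seq I) (w : I -> R).

Fixpoint lists (n : nat) : seq (seq I) :=
  if n is m.+1 then [seq x :: t | x <- ts, t <- lists m] else [:: [::]].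

Definition weight (t : seq I) : R := \prod_(x <- t) w x.

Definition expect (n : nat) (g : seq I -> R) : R :=
  \sum_(t <- lists n) weight t * g t.

Lemma size_lists (n : nat) (t : seq I) : t \in lists n -> size t = n.
Proof.
elim: n t => [|n IHn] t /=; first by rewrite inE => /eqP ->.
by case/allpairsP=> -[x u] [_ /IHn <- ->].
Qed.

Lemma expect0 (g : seq I -> R) : expect 0 g = g [::].
Proof. by rewrite /expect /= big_seq1 /weight big_nil mul1r. Qed.

Lemma expectS (n : nat) (g : seq I -> R) :
  expect n.+1 g = \sum_(x <- ts) w x * expect n (fun t => g (x :: t)).
Proof.
rewrite /expect /= big_allpairs_dep; apply: eq_bigr => x _.
by rewrite mulr_sumr; apply: eq_bigr => t _; rewrite /weight big_cons mulrA.
Qed.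

Lemma eq_expect (n : nat) (g g' : seq I -> R) :
  (forall t, t \in lists n -> g t = g' t) -> expect n g = expect n g'.
Proof.
by move=> gg'; rewrite /expect !big_seq; apply: eq_bigr => t /gg' ->.
Qed.

Lemma expect_cat (m n : nat) (g : seq I -> R) :
  expect (m + n) g = expect m (fun s => expect n (fun t => g (s ++ t))).
Proof.
elim: m g => [|m IHm] g; first by rewrite expect0.
by rewrite addSn !expectS; apply: eq_bigr => x _; rewrite IHm.
Qed.

Lemma expectD (n : nat) (g h : seq I -> R) :
  expect n (fun t => g t + h t) = expect n g + expect n h.
Proof. by rewrite -big_split; apply: eq_bigr => t _; rewrite mulrDr. Qed.

Lemma expectZ (n : nat) (c : R) (g : seq I -> R) :
  expect n (fun t => c * g t) = c * expect n g.
Proof. by rewrite mulr_sumr; apply: eq_bigr => t _; rewrite mulrCA. Qed.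

Lemma expect_sum (n : nat) (J : Type) (r : seq J) (g : J -> seq I -> R) :
  expect n (fun t => \sum_(j <- r) g j t) = \sum_(j <- r) expect n (g j).
Proof.
by rewrite exchange_big; apply: eq_bigr => t _; rewrite mulr_sumr.
Qed.

Hypothesis w_ge0 : forall x, 0 <= w x.

Lemma weight_ge0 (t : seq I) : 0 <= weight t.
Proof. exact: prodr_ge0. Qed.

Lemma ler_expect (n : nat) (g h : seq I -> R) :
  (forall t, t \in lists n -> g t <= h t) -> expect n g <= expect n h.
Proof.
move=> gh; rewrite /expect !big_seq; apply: ler_sum => t tn.
by rewrite ler_wpM2l ?weight_ge0 ?gh.
Qed.

Lemma expect_ge0 (n : nat) (g : seq I -> R) :
  (forall t, 0 <= g t) -> 0 <= expect n g.
Proof. by move=> g0; apply: sumr_ge0 => t _; rewrite mulr_ge0 ?weight_ge0. Qed.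

Hypothesis w_sum1 : \sum_(x <- ts) w x = 1.

Lemma expect_cst (n : nat) (c : R) : expect n (fun=> c) = c.
Proof.
elim: n => [|n IHn]; first by rewrite expect0.
by rewrite expectS; under eq_bigr do rewrite IHn;
  rewrite -mulr_suml w_sum1 mul1r.
Qed.

End Expectation.

(** * A subgraph denser than 7/2 from a family of trees *)

Section Family.
Variables (R : realType) (ts : seq tree) (w : tree -> R) (H : pred tree).
Variables (p eta : R).
Hypothesis ts_uniq : uniq ts.
Hypothesis w_ge0 : forall T, 0 <= w T.
Hypothesis w_sum1 : \sum_(T <- ts) w T = 1.
Hypothesis Leaf_ts : Leaf \in ts.
Hypothesis w_Leaf : w Leaf = p.
Hypothesis Node_ts : forall A B, Node A B \in ts -> (A \in ts) && (B \in ts).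
Hypothesis w_Node : forall A B, w (Node A B) <= w A * w B.
Hypothesis H_Leaf : ~~ H Leaf.
Hypothesis H_Node : forall A B, Node A B \in ts ->
  ~~ ((A == Leaf) && H B) && ~~ (H A && (B == Leaf)).
Hypothesis w_H : \sum_(T <- ts | H T) w T = eta.

Local Notation E := (expect ts w).

(** A default leaf past the end of the sequence is harmless, as the last tree of
the stretch must satisfy H. *)
Definition stretch (i : nat) (t : seq tree) : bool :=
  [&& nth Leaf t i == Leaf, H (nth Leaf t i.+1),
      nth Leaf t i.+2 == Leaf & H (nth Leaf t i.+3)].

(** The value of the test function at the state pointing to tree number a + 2:
the first three trees of a stretch starting at a, a + 1 or a + 2 include this
one. *)
Definition kept (a : nat) (t : seq tree) : R :=
  1 - ((stretch a t)%:R + (stretch a.+1 t)%:R + (stretch a.+2 t)%:R) / 2.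

Lemma sum_Leaf : \sum_(T <- ts | T == Leaf) w T = p.
Proof.
by rewrite -big_filter (filter_pred1_uniq ts_uniq Leaf_ts) big_seq1 w_Leaf.
Qed.

Lemma expectS_and (n : nat) (q : pred tree) (g b : pred (seq tree)) :
  (forall T t, g (T :: t) = q T && b t) ->
  E n.+1 (fun t => (g t)%:R) =
    (\sum_(T <- ts | q T) w T) * E n (fun t => (b t)%:R).
Proof.
move=> gE; rewrite expectS [in RHS]big_mkcond mulr_suml; apply: eq_bigr => T _.
under eq_expect => t _ do rewrite gE -mulnb natrM.
by rewrite expectZ mulrA; case: (q T); rewrite ?mulr1 ?mulr0 ?mul0r.
Qed.

Lemma stretch_cat (s t : seq tree) (k : nat) :
  stretch (size s + k) (s ++ t) = stretch k t.
Proof. by rewrite /stretch -!addnS !nth_cat !ltnNge !leq_addr /= !addKn. Qed.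

Lemma expect_shift (m n : nat) (g h : seq tree -> R) :
  (forall s t, size s = m -> g (s ++ t) = h t) -> E (m + n) g = E n h.
Proof.
move=> gh; rewrite expect_cat -[RHS](expect_cst w_sum1 m).
by apply: eq_expect => s /size_lists sm; apply: eq_expect => t _; exact: gh.
Qed.

Lemma expect_stretch (i n : nat) : (i + 4 <= n)%N ->
  E n (fun t => (stretch i t)%:R) = (p * eta) ^+ 2.
Proof.
move=> /subnKC <-; move: (n - _)%N => r; rewrite -addnA.
rewrite (@expect_shift _ _ _ (fun t => (stretch 0 t)%:R)) => [|s t <-];
  last first.
  by rewrite -[in LHS](addn0 (size s)) stretch_cat.
rewrite (@expectS_and _ (pred1 Leaf) _ (fun t => [&& H (nth Leaf t 0),
  nth Leaf t 1 == Leaf & H (nth Leaf t 2)])) //.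
rewrite (@expectS_and _ H _ (fun t =>
  (nth Leaf t 0 == Leaf) && H (nth Leaf t 1))) //.
rewrite (@expectS_and _ (pred1 Leaf) _ (fun t => H (nth Leaf t 0))) //.
rewrite (@expectS_and _ H _ xpredT) => [|T t]; last by rewrite andbT.
by rewrite (expect_cst w_sum1) sum_Leaf w_H mulr1n; ring.
Qed.

Lemma kept_le1 (a : nat) (t : seq tree) : kept a t <= 1.
Proof. by rewrite /kept lerBlDr lerDl divr_ge0 ?addr_ge0. Qed.

(** Stretches starting at a and a + 1 exclude each other. *)
Lemma kept_ge0 (a : nat) (t : seq tree) : 0 <= kept a t.
Proof.
have excl : ~~ (stretch a t && stretch a.+1 t).
  apply/negP => /andP[/and4P[_ h _ _] /and4P[/eqP e _ _ _]].
  by move: h; rewrite e (negbTE H_Leaf).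
rewrite /kept; move: excl.
by case: (stretch a t); case: (stretch a.+1 t); case: (stretch a.+2 t) => //= _;
  lra.
Qed.

(** A tree splits in only one way, so the sum over trees is a part of the sum
over pairs. *)
Lemma sum_merge (Q : tree -> R) (Q' : tree -> tree -> R) :
  Q Leaf <= 0 -> (forall A B, 0 <= Q' A B) ->
  (forall A B, Node A B \in ts -> Q (Node A B) <= Q' A B) ->
  \sum_(T <- ts) w T * Q T <=
    \sum_(A <- ts) w A * \sum_(B <- ts) w B * Q' A B.
Proof.
move=> Q0 Q'0 QQ'.
pose ch T := if T is Node A B then (A, B) else (Leaf, Leaf).
pose G AB := w AB.1 * w AB.2 * Q' AB.1 AB.2.
have -> : \sum_(A <- ts) w A * \sum_(B <- ts) w B * Q' A B =
    \sum_(AB <- [seq (A, B) | A <- ts, B <- ts]) G AB.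
  rewrite big_allpairs; apply: eq_bigr => A _; rewrite mulr_sumr.
  by apply: eq_bigr => B _; rewrite mulrA.
pose nodes := [seq T <- ts | T != Leaf].
apply: (@le_trans _ _ (\sum_(AB <- map ch nodes) G AB)).
  rewrite big_map big_filter (bigID (fun T => T == Leaf)) /=.
  rewrite -[leRHS]add0r; apply: lerD.
    apply: sumr_le0 => T /eqP ->; exact: mulr_ge0_le0.
  rewrite big_seq_cond [leRHS]big_seq_cond; apply: ler_sum.
  move=> -[|A B]; rewrite ?eqxx ?andbF //.
  move=> /andP[ABts _]; apply: le_trans (_ : w (Node A B) * Q' A B <= _).
    by rewrite ler_wpM2l ?QQ'.
  by rewrite /G /= ler_wpM2r.
apply: ler_sum_subset => [|||AB].
- rewrite map_inj_in_uniq ?filter_uniq // => -[|A B] [|A' B'] //;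
    by rewrite !mem_filter ?eqxx // => _ _ [-> ->].
- by rewrite allpairs_uniq // => -[? ?] [? ?].
- move=> AB /mapP[[|A B]]; rewrite mem_filter ?eqxx //= => /andP[_].
  move=> /Node_ts/andP[Ats Bts] ->.
  by apply/allpairsP; exists (A, B).
- by rewrite /G !mulr_ge0.
Qed.

(** A lower bound for [kept] at both ends of the x_0-edge between the pointers
a + 2 and a + 3. *)
Definition kept_x0 (a : nat) (t : seq tree) : R :=
  1 - ((stretch a t)%:R + (stretch a.+1 t)%:R + (stretch a.+2 t)%:R +
    (stretch a.+3 t)%:R) / 2.

(** The value at the joined end of the x_1-edge that splits the pointed tree; at
the other end the value is 1 by [kept_split]. *)
Definition kept_x1 (a : nat) (t : seq tree) : R :=
  (nth Leaf t a.+2 != Leaf)%:R * kept a t.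

(** The value at g of the image measure, on the group, of k times the law of n
independent trees with pointer a + 2. *)
Definition fiber_mass (a n : nat) (k : seq tree -> R) (g : F) : R :=
  E n (fun t => k t * (vertex a.+2 t == g)%:R).

(** The test function.  The pointer has at least two trees before it and four
trees from it on, so that every stretch covering it lies inside the sequence. *)
Definition vertex_mass (M : nat) (g : F) : R :=
  \sum_(a < M) \sum_(b < M) fiber_mass a (a + b + 6) (kept a) g.

Lemma fiber_mass_ge0 (a n : nat) (k : seq tree -> R) (g : F) :
  (forall t, 0 <= k t) -> 0 <= fiber_mass a n k g.
Proof. by move=> k0; apply: expect_ge0 => // t; rewrite mulr_ge0. Qed.

Lemma vertex_mass_ge0 (M : nat) (g : F) : 0 <= vertex_mass M g.
Proof.
do 2![apply: sumr_ge0 => ? _]; apply: fiber_mass_ge0 => t; exact: kept_ge0.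
Qed.

Definition support (M : nat) : {fset F} :=
  [fset g in [seq vertex a.+2 t |
    a <- iota 0 M, t <- flatten [seq lists ts n | n <- iota 0 (M + M + 6)]]].

Lemma vertex_in_support (M a b : nat) (t : seq tree) :
  (a < M)%N -> (b < M)%N -> t \in lists ts (a + b + 6) ->
  vertex a.+2 t \in support M.
Proof.
move=> aM bM tn; rewrite inE; apply/allpairsP; exists (a, t); split=> //=.
  by rewrite mem_iota.
apply/flattenP; exists (lists ts (a + b + 6)) => //; apply: map_f.
by rewrite mem_iota /=; lia.
Qed.

Lemma sum_fiber_mass (M a b : nat) (k : seq tree -> R) :
  (a < M)%N -> (b < M)%N ->
  \sum_(g <- support M) fiber_mass a (a + b + 6) k g = E (a + b + 6) k.
Proof.
move=> aM bM; rewrite -expect_sum; apply: eq_expect => t tn.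
rewrite -mulr_sumr (big_fsetD1 _ (vertex_in_support aM bM tn)) /= eqxx.
rewrite big_seq big1 ?addr0 ?mulr1 // => g; rewrite !inE => /andP[].
by rewrite eq_sym => /negbTE ->.
Qed.

Lemma vertex_mass_support (M : nat) (g : F) :
  g \notin support M -> vertex_mass M g = 0.
Proof.
move=> gM; apply: big1 => a _; apply: big1 => b _.
rewrite -[RHS](expect_cst w_sum1 (a + b + 6)); apply: eq_expect => t tn.
case: eqP => [vg|_]; last by rewrite mulr0.
by move: gM; rewrite -vg (vertex_in_support (ltn_ord a) (ltn_ord b) tn).
Qed.

Local Notation pi2 := ((p * eta) ^+ 2).

Lemma expect_kept (a b : nat) :
  E (a + b + 6) (kept a) = 1 - 3 / 2 * pi2.
Proof.
have -> : E (a + b + 6) (kept a) = E (a + b + 6) (fun t => 1 +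
    - 2^-1 * ((stretch a t)%:R + (stretch a.+1 t)%:R + (stretch a.+2 t)%:R)).
  by apply: eq_expect => t _; rewrite /kept mulNr mulrC.
rewrite expectD (expect_cst w_sum1) expectZ !expectD !expect_stretch; try lia.
by field.
Qed.

Lemma expect_kept_x0 (a b : nat) : E (a + b + 7) (kept_x0 a) = 1 - 2 * pi2.
Proof.
have -> : E (a + b + 7) (kept_x0 a) = E (a + b + 7) (fun t => 1 + - 2^-1 *
    ((stretch a t)%:R + (stretch a.+1 t)%:R + (stretch a.+2 t)%:R +
     (stretch a.+3 t)%:R)).
  by apply: eq_expect => t _; rewrite /kept_x0 mulNr mulrC.
rewrite expectD (expect_cst w_sum1) expectZ !expectD !expect_stretch; try lia.
by field.
Qed.

(** Of the stretches covering the pointer only the one starting at a + 1 has a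
pointed tree that is not a leaf. *)
Lemma expect_kept_x1 (a b : nat) :
  1 - p - pi2 / 2 <= E (a + b + 6) (kept_x1 a).
Proof.
have E1 : E (a + b + 6) (fun t => (nth Leaf t a.+2 != Leaf)%:R) = 1 - p.
  have -> : (a + b + 6 = a.+2 + (b + 3).+1)%N by lia.
  rewrite (@expect_shift _ _ _ (fun t => (nth Leaf t 0 != Leaf)%:R)).
    rewrite (@expectS_and _ (predC1 Leaf) _ xpredT) => [|T t]; last first.
      by rewrite andbT.
    rewrite (expect_cst w_sum1) mulr1 -w_sum1 [in RHS](bigID (pred1 Leaf)) /=.
    by rewrite sum_Leaf [X in _ = X - _]addrC addrK.
  by move=> s t sa; rewrite nth_cat sa ltnn subnn.
rewrite -E1 [pi2 / 2]mulrC -(@expect_stretch a.+1 (a + b + 6)); last by lia.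
rewrite -mulNr -expectZ -expectD; apply: ler_expect => // t _.
rewrite /kept_x1 /kept.
have [nL|nL] := eqVneq (nth Leaf t a.+2) Leaf.
  by rewrite mul0r add0r mulNr oppr_le0 mulr_ge0 ?invr_ge0 ?ler0n.
have -> : stretch a t = false by rewrite /stretch (negbTE nL) !andbF.
have -> : stretch a.+2 t = false by rewrite /stretch (negbTE nL).
by rewrite mul1r add0r addr0 mulNr mulrC.
Qed.

(** A stretch covering the pointer would show a leaf next to an element of H at
the place of A and B, but such a pair has no caret. *)
Lemma kept_split (s : seq tree) (A B : tree) (t : seq tree) (a : nat) :
  size s = a.+2 -> Node A B \in ts -> kept a (s ++ A :: B :: t) = 1.
Proof.
move=> sa /H_Node/andP[nLH nHL].
have nA : nth Leaf (s ++ A :: B :: t) a.+2 = A by rewrite nth_cat sa ltnn subnn.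
have nB : nth Leaf (s ++ A :: B :: t) a.+3 = B.
  by rewrite nth_cat sa ltnNge leqnSn /= subSnn.
rewrite /kept /stretch nA nB.
move: nLH nHL; case: (A == Leaf); case: (H B); case: (H A); case: (B == Leaf);
  by rewrite //= ?andbF /= !addr0 mul0r subr0.
Qed.

Lemma fiber_mass_x0 (a b : nat) (g : F) :
  fiber_mass a.+1 (a + b + 7) (kept_x0 a) g <=
    fiber_mass a.+1 (a.+1 + b + 6) (kept a.+1) g /\
  fiber_mass a.+1 (a + b + 7) (kept_x0 a) g <=
    fiber_mass a (a + b.+1 + 6) (kept a) (g * F_gen 0)%g.
Proof.
have -> : (a.+1 + b + 6 = a + b + 7)%N by lia.
have -> : (a + b.+1 + 6 = a + b + 7)%N by lia.
split; apply: ler_expect => // t _; last first.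
  rewrite -(vertex_x0 a.+2) (inj_eq (mulIg _)) ler_wpM2r //.
  rewrite /kept_x0 /kept lerD2l lerN2 ler_pM2r ?invr_gt0 ?ltr0n //.
  by rewrite lerDl ler0n.
rewrite ler_wpM2r // /kept_x0 /kept lerD2l lerN2 ler_pM2r ?invr_gt0 ?ltr0n //.
by rewrite -!addrA lerDr ler0n.
Qed.

Lemma fiber_mass_x1 (a b : nat) (g : F) :
  fiber_mass a (a + b + 6) (kept_x1 a) g <=
    fiber_mass a (a + b + 6) (kept a) g /\
  fiber_mass a (a + b + 6) (kept_x1 a) g <=
    fiber_mass a (a + b.+1 + 6) (kept a) (g * F_gen 1)%g.
Proof.
split.
  apply: ler_expect => // t _; rewrite ler_wpM2r // /kept_x1.
  by rewrite ler_piMl ?kept_ge0 // lern1 leq_b1.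
have -> : (a + b + 6 = a.+2 + (b + 3).+1)%N by lia.
have -> : (a + b.+1 + 6 = a.+2 + (b + 3).+2)%N by lia.
rewrite /fiber_mass !expect_cat; apply: ler_expect => // s /size_lists sa.
rewrite expectS [leRHS]expectS; under [leRHS]eq_bigr do rewrite expectS.
apply: sum_merge => [|A B|A B ABts].
- rewrite -(expect_cst w_sum1 (b + 3) 0); apply: ler_expect => // t _.
  by rewrite /kept_x1 nth_cat sa ltnn subnn /= eqxx !mul0r.
- by apply: expect_ge0 => // t; rewrite mulr_ge0 ?kept_ge0.
- apply: ler_expect => // t _; rewrite kept_split // -sa.
  rewrite -vertex_x1 (inj_eq (mulIg _)) ler_wpM2r // /kept_x1.
  by rewrite mulr_ile1 ?kept_ge0 ?kept_le1 // lern1 leq_b1.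
Qed.

Lemma square_sum_cst (M : nat) (c : R) :
  \sum_(a < M) \sum_(b < M) c = M%:R ^+ 2 * c.
Proof.
under eq_bigr do rewrite sumr_const card_ord.
by rewrite sumr_const card_ord -mulrnA -[LHS]mulr_natl natrM.
Qed.

Lemma sum_vertex_mass (M : nat) :
  \sum_(g <- support M) vertex_mass M g = M%:R ^+ 2 * (1 - 3 / 2 * pi2).
Proof.
rewrite /vertex_mass exchange_big -square_sum_cst; apply: eq_bigr => a _ /=.
rewrite exchange_big; apply: eq_bigr => b _ /=.
by rewrite sum_fiber_mass // expect_kept.
Qed.

Lemma flow_x0 (M : nat) : M%:R ^+ 2 * (1 - 2 * pi2) <=
  \sum_(g <- support M.+1)
    Num.min (vertex_mass M.+1 g) (vertex_mass M.+1 (g * F_gen 0)%g).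
Proof.
apply: (@le_trans _ _ (\sum_(g <- support M.+1)
    \sum_(a < M) \sum_(b < M) fiber_mass a.+1 (a + b + 7) (kept_x0 a) g)).
  rewrite exchange_big -square_sum_cst; apply: ler_sum => a _ /=.
  rewrite exchange_big; apply: ler_sum => b _ /=; rewrite -(expect_kept_x0 a b).
  have -> : (a + b + 7 = a.+1 + b + 6)%N by lia.
  by rewrite sum_fiber_mass ?ltnS // ltnW.
apply: ler_sum => g _; rewrite le_min; apply/andP; split.
  apply: (@le_trans _ _ _ _ _ _ (@square_sum_left _ (fun a b =>
    fiber_mass a (a + b + 6) (kept a) g) M _)).
    by apply: ler_sum => a _; apply: ler_sum => b _;
      have [] := fiber_mass_x0 a b g.
  by move=> a b; apply: fiber_mass_ge0; exact: kept_ge0.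
apply: (@le_trans _ _ _ _ _ _ (@square_sum_right _ (fun a b =>
  fiber_mass a (a + b + 6) (kept a) (g * F_gen 0)%g) M _)).
  by apply: ler_sum => a _; apply: ler_sum => b _;
    have [] := fiber_mass_x0 a b g.
by move=> a b; apply: fiber_mass_ge0; exact: kept_ge0.
Qed.

Lemma flow_x1 (M : nat) : M%:R ^+ 2 * (1 - p - pi2 / 2) <=
  \sum_(g <- support M.+1)
    Num.min (vertex_mass M.+1 g) (vertex_mass M.+1 (g * F_gen 1)%g).
Proof.
apply: (@le_trans _ _ (\sum_(g <- support M.+1)
    \sum_(a < M) \sum_(b < M) fiber_mass a (a + b + 6) (kept_x1 a) g)).
  rewrite exchange_big -square_sum_cst; apply: ler_sum => a _ /=.
  rewrite exchange_big; apply: ler_sum => b _ /=.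
  by rewrite sum_fiber_mass ?expect_kept_x1 // ltnS ltnW.
apply: ler_sum => g _; rewrite le_min; apply/andP; split.
  apply: (@le_trans _ _ _ _ _ _ (@square_sum_lower _ (fun a b =>
    fiber_mass a (a + b + 6) (kept a) g) M _)).
    by apply: ler_sum => a _; apply: ler_sum => b _;
      have [] := fiber_mass_x1 a b g.
  by move=> a b; apply: fiber_mass_ge0; exact: kept_ge0.
apply: (@le_trans _ _ _ _ _ _ (@square_sum_right _ (fun a b =>
  fiber_mass a (a + b + 6) (kept a) (g * F_gen 1)%g) M _)).
  by apply: ler_sum => a _; apply: ler_sum => b _;
    have [] := fiber_mass_x1 a b g.
by move=> a b; apply: fiber_mass_ge0; exact: kept_ge0.
Qed.

(** Compare M^2 states of each end of the edges with the (M + 1)^2 states that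
carry the test function, and let M grow. *)
Lemma dense_subgraph (d : R) : 0 <= d ->
  d * (1 - 3 / 2 * pi2) < 2 - p - 5 / 2 * pi2 ->
  exists2 Y : {fset F}, Y != fset0 &
    d * #|` Y|%:R < (labelled_edges F_gens Y)%:R.
Proof.
move=> d0 gap; apply: contrapT => noY.
have ub (Y : {fset F}) : Y != fset0 ->
    (labelled_edges F_gens Y)%:R <= d * #|` Y|%:R.
  by move=> Y0; rewrite leNgt; apply/negP => dY; apply: noY; exists Y.
set v := 1 - _ in gap; set e := _ - _ in gap.
have bound M : M%:R ^+ 2 * e <= d * (M.+1%:R ^+ 2 * v).
  rewrite -sum_vertex_mass.
  apply: le_trans (coarea ub (@vertex_mass_ge0 _) (@vertex_mass_support _)).
  rewrite /F_gens big_fsetU1 ?inE ?F_gen01 //= big_seq_fset1.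
  apply: le_trans (lerD (flow_x0 M) (flow_x1 M)).
  by rewrite -mulrDr ler_wpM2l ?sqr_ge0 // /e; lra.
pose c := 3 * `|d * v| / (e - d * v).
have ev : 0 < e - d * v by rewrite subr_gt0.
have [M cM] : exists M : nat, c < M.+1%:R.
  exists (Num.bound c); apply: lt_le_trans (archi_boundP _) _.
    by rewrite divr_ge0 ?(ltW ev) // mulr_ge0.
  by rewrite ler_nat.
have := bound M.+1; move: cM; rewrite /c ltr_pdivrMr // -[M.+2]addn1 natrD.
have := ler_norm (d * v); set N := `|_|; set m := M.+1%:R.
have m1 : 1 <= m :> R by rewrite ler1n.
move=> vN cM b.
have : m ^+ 2 * (e - d * v) <= (2 * m + 1) * (d * v).
  by move: b; lra.
apply/negP; rewrite -ltNge; apply: (@le_lt_trans _ _ (3 * m * N)).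
  have N0 : 0 <= N by exact: normr_ge0.
  nra.
nra.
Qed.

End Family.

(** * A family of trees with many trees that avoid leaves *)

Fixpoint leaves (T : tree) : nat :=
  if T is Node A B then (leaves A + leaves B)%N else 1%N.

(** The list W limits the joining with leaves: for W = U every pair of trees
among the leaf and U is joined, for a smaller W the trees of U outside W are
kept away from leaves. *)
Definition carets (U W : seq tree) : seq tree :=
  [seq Node A B | A <- U, B <- U] ++
  ([seq Node Leaf B | B <- W] ++ [seq Node A Leaf | A <- W] ++
   [:: Node Leaf Leaf]).

Lemma mem_carets (U W : seq tree) (A B : tree) :
  Node A B \in carets U W =
    [|| (A \in U) && (B \in U), (A == Leaf) && (B \in W),
        (A \in W) && (B == Leaf) | (A == Leaf) && (B == Leaf)].
Proof.
rewrite !mem_cat mem_seq1; congr [|| _, _, _ | _].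
- apply/allpairsP/andP => [[[A' B'] [AU BU [-> ->]]] //|[AU BU]].
  by exists (A, B).
- by apply/mapP/andP => [[B' BW [-> ->]]|[/eqP -> BW]]; [rewrite eqxx|exists B].
- by apply/mapP/andP => [[A' AW [-> ->]]|[AW /eqP ->]]; [rewrite eqxx|exists A].
- by apply/eqP/andP => [[-> ->]|[/eqP -> /eqP ->]].
Qed.

Lemma Leaf_carets (U W : seq tree) : Leaf \notin carets U W.
Proof.
apply/negP; rewrite !mem_cat mem_seq1.
by case/or4P => [/allpairsP[[? ?] []]|/mapP[]|/mapP[]|/eqP].
Qed.

Lemma carets_uniq (U W : seq tree) :
  uniq U -> uniq W -> Leaf \notin U -> Leaf \notin W -> uniq (carets U W).
Proof.
move=> uU uW LU LW.
have notin T U' : Leaf \notin U' -> T \in U' -> T <> Leaf.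
  by move=> LU' TU' TL; rewrite -TL TU' in LU'.
rewrite !cat_uniq; apply/and3P; split.
    by rewrite allpairs_uniq // => -[? ?] [? ?] _ _ [-> ->].
  apply/hasPn => T.
  rewrite !mem_cat mem_seq1 => TW; apply/allpairsP => -[[A B] /= [AU BU TE]].
  move: TW; rewrite TE => /or3P[/mapP[? _ []]|/mapP[? _ []]|/eqP[]].
  - by move=> AL _; exact: notin AU AL.
  - by move=> _ BL; exact: notin BU BL.
  - by move=> AL _; exact: notin AU AL.
apply/and3P; split; first by rewrite map_inj_uniq // => ? ? [].
  apply/hasPn => T; rewrite mem_cat mem_seq1 => TW; apply/mapP => -[B BW TE].
  move: TW; rewrite TE => /orP[/mapP[A AW []]|/eqP[]].
  - by move=> AL _; exact: notin AW (esym AL).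
  - exact: notin BW.
apply/and3P; split=> //; first by rewrite map_inj_uniq // => ? ? [].
apply/hasPn => T; rewrite mem_seq1 => /eqP ->; apply/mapP => -[A AW [AL]].
exact: notin AW (esym AL).
Qed.

Lemma carets_mono (U U' W W' : seq tree) :
  {subset U <= U'} -> {subset W <= W'} ->
  {subset carets U W <= carets U' W'}.
Proof.
move=> UU WW [|A B]; first by rewrite (negbTE (Leaf_carets _ _)).
rewrite !mem_carets => /or4P[/andP[/UU -> /UU ->]|/andP[-> /WW ->]|
  /andP[/WW -> ->]|->]; by rewrite ?orbT.
Qed.

Section Mass.
Variables (R : comPzRingType) (x : R).

Definition mass (U : seq tree) : R := \sum_(T <- U) x ^+ leaves T.

Lemma mass_carets (U W : seq tree) :
  mass (carets U W) = mass U ^+ 2 + 2 * x * mass W + x ^+ 2.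
Proof.
rewrite /mass !big_cat big_allpairs_dep /= !big_map big_seq1 /= addn1.
under eq_bigr => A _.
  under eq_bigr => B _ do rewrite exprD.
  rewrite -mulr_sumr.
  over.
rewrite -mulr_suml.
under [X in _ + (X + _)]eq_bigr do rewrite exprD expr1.
under [X in _ + (_ + (X + _))]eq_bigr do rewrite exprD expr1.
by rewrite -mulr_sumr -mulr_suml; ring.
Qed.

End Mass.

Definition tall (k : nat) : seq tree := iter k (fun U => carets U U) [::].
Definition extend (W : seq tree) (n : nat) : seq tree :=
  iter n (fun V => carets V W) W.

Lemma tall_wf (k : nat) : uniq (tall k) && (Leaf \notin tall k).
Proof.
elim: k => // k /andP[u l]; rewrite /tall iterS -/(tall k).
by rewrite carets_uniq ?Leaf_carets.
Qed.

Lemma extend_wf (k n : nat) :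
  uniq (extend (tall k) n) && (Leaf \notin extend (tall k) n).
Proof.
have /andP[uW lW] := tall_wf k.
elim: n => [|n /andP[u l]]; first by rewrite uW.
by rewrite /extend iterS carets_uniq ?Leaf_carets.
Qed.

Lemma tall_sub (k : nat) : {subset tall k <= tall k.+1}.
Proof.
by elim: k => [|k IHk] //; apply: carets_mono.
Qed.

Lemma extend_sub (k n : nat) :
  {subset extend (tall k) n <= extend (tall k) n.+1}.
Proof.
elim: n => [|n IHn]; first exact: tall_sub.
by apply: carets_mono.
Qed.

Lemma tall_extend (k n : nat) : {subset tall k <= extend (tall k) n}.
Proof. by elim: n => // n IHn T /IHn/extend_sub. Qed.

Lemma Node_family (k n : nat) (A B : tree) :
  Node A B \in Leaf :: extend (tall k) n.+1 ->
  (A \in Leaf :: extend (tall k) n.+1) && (B \in Leaf :: extend (tall k) n.+1).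
Proof.
have sub := @extend_sub k n; have tsub := @tall_extend k n.+1.
rewrite inE => /orP[/eqP //|].
rewrite {1}/extend iterS mem_carets -/(extend _ _) !inE.
by case/or4P => /andP[] => [/sub -> /sub ->|-> /tsub ->|/tsub -> ->|-> ->];
  rewrite ?orbT.
Qed.

(** The layers above height k are out of the reach of leaves in [carets]. *)
Definition late (k n : nat) : pred tree :=
  [pred T | (T \in extend (tall k) n) && (T \notin tall k)].

Lemma Leaf_late (k n : nat) : ~~ late k n Leaf.
Proof. by have /andP[_ /negbTE VL] := extend_wf k n; rewrite /late /= VL. Qed.

Lemma Node_late (k n : nat) (A B : tree) :
  Node A B \in Leaf :: extend (tall k) n.+1 ->
  ~~ ((A == Leaf) && late k n.+1 B) && ~~ (late k n.+1 A && (B == Leaf)).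
Proof.
have /andP[_ /negbTE VL] := extend_wf k n.
have /andP[_ /negbTE WL] := tall_wf k.
have late_Leaf := negbTE (Leaf_late k n.+1).
rewrite inE => /orP[/eqP //|].
rewrite {1}/extend iterS mem_carets -/(extend _ _) => AB.
apply/andP; split; apply/negP => /andP[].
  move=> /eqP AL lB; move: AB; rewrite AL VL WL eqxx /=.
  case/orP => [BW|/eqP BL]; last by rewrite BL late_Leaf in lB.
  by move: lB; rewrite /late /= BW andbF.
move=> lA /eqP BL; move: AB; rewrite BL VL WL eqxx !andbF !andbT /=.
case/orP => [AW|/eqP AL]; last by rewrite AL late_Leaf in lA.
by move: lA; rewrite /late /= AW andbF.
Qed.

(** At 1/4 the masses of nontrivial trees stay below the fixed point 1/4 of
u |-> (u + 1/4)^2; above 1/4 there is no fixed point, and each layer adds at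
least e to the mass.  The total weight is a polynomial in x, so it takes the
value 1 in between. *)
Lemma critical_family (R : realType) (e : R) : 0 < e ->
  exists k x, 1 / 4 <= x <= 1 / 4 + e /\
    x + mass x (extend (tall k) 3) = 1.
Proof.
move=> e0; pose y := 1 / 4 + e.
have y0 : 0 <= y by rewrite /y; lra.
have [k ke] : exists k : nat, 1 <= k%:R * e.
  exists (Num.bound e^-1); rewrite -ler_pdivrMr // div1r; apply: ltW.
  by apply: archi_boundP; rewrite invr_ge0 ltW.
have grow : 1 <= mass y (tall k).
  apply: le_trans ke _; elim: k => [|k IHk].
    by rewrite mul0r /mass big_nil.
  rewrite /tall iterS -/(tall k) mass_carets -addn1 natrD mulrDl mul1r.
  have := sqr_ge0 (mass y (tall k) - 1 / 4 + e); rewrite /y; nra.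
have small n : mass (1 / 4 : R) (tall n) <= 1 / 4.
  elim: n => [|n IHn]; first by rewrite /mass big_nil; lra.
  have m0 : 0 <= mass (1 / 4 : R) (tall n).
    by apply: sumr_ge0 => T _; rewrite exprn_ge0 //; lra.
  rewrite /tall iterS -/(tall n) mass_carets; nra.
have small3 n : mass (1 / 4 : R) (extend (tall k) n) <= 1 / 4.
  elim: n => [|n IHn]; first exact: small.
  have m0 : 0 <= mass (1 / 4 : R) (extend (tall k) n).
    by apply: sumr_ge0 => T _; rewrite exprn_ge0 //; lra.
  rewrite /extend iterS -/(extend _ _) mass_carets; have := small k; nra.
pose P : {poly R} := 'X + \sum_(T <- extend (tall k) 3) 'X ^+ leaves T - 1.
have PE z : P.[z] = z + mass z (extend (tall k) 3) - 1.
  rewrite /P !hornerE horner_sum; congr (_ + _ - _).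
  by apply: eq_bigr => T _; rewrite hornerXn.
have [||x xy /rootP] := @poly_ivt R P (1 / 4) y.
- by rewrite /y; lra.
- rewrite !PE; apply/andP; split; first by have := small3 3%N; lra.
  have : mass y (tall k) <= mass y (extend (tall k) 3).
    have /andP[uW _] := tall_wf k; have /andP[uV _] := extend_wf k 3.
    apply: ler_sum_subset => //; first exact: tall_extend.
    by move=> T; rewrite exprn_ge0.
  lra.
by rewrite PE => Px; exists k, x; split=> //; lra.
Qed.

(** The mass s of the trees of height at most k determines the three further
masses; were s above 0.765 - x, the total weight would exceed 1. *)
Lemma dense_F (R : realType) : exists2 Y : {fset F}, Y != fset0 &
  1750373%:R / 10 ^+ 6 * #|` Y|%:R < (labelled_edges F_gens Y)%:R :> R.
Proof.
have [|k [x [/andP[x_lo x_hi] x1]]] := @critical_family R (1 / 50000%:R).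
  by lra.
have x0 : 0 <= x by lra.
have mass0 U : 0 <= mass x U by apply: sumr_ge0 => T _; rewrite exprn_ge0.
have /andP[uV VL] := extend_wf k 3; have /andP[uW WL] := tall_wf k.
set s := mass x (tall k).
have s0 : 0 <= s := mass0 _.
have late_mass :
    \sum_(T <- Leaf :: extend (tall k) 3 | late k 3 T) x ^+ leaves T = 1 - x - s.
  rewrite big_cons (negbTE (Leaf_late k 3)).
  have -> : 1 - x = mass x (extend (tall k) 3) by rewrite -x1 addrC addKr.
  rewrite /mass (sum_subset _ uW uV (@tall_extend k 3)) /s [RHS]addrC addKr.
  rewrite big_seq_cond [RHS]big_seq_cond; apply: eq_bigl => T.
  by rewrite /late inE andbA andbb.
have eta_lo : 235%:R / 1000%:R <= 1 - x - s.
  rewrite leNgt; apply/negP => s_hi.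
  have := x1; rewrite /extend !iterS !mass_carets /= -/s => eqn.
  have C_lo : 31999%:R / 100000%:R <= 2 * x * s + x ^+ 2 by nra.
  have v1_lo : 58522%:R / 100000%:R <= s ^+ 2 + 2 * x * s + x ^+ 2 by nra.
  set v1 := s ^+ 2 + _ + _ in eqn v1_lo.
  have v2_lo : 66247%:R / 100000%:R <= v1 ^+ 2 + 2 * x * s + x ^+ 2 by nra.
  set v2 := v1 ^+ 2 + _ + _ in eqn v2_lo.
  nra.
apply: (@dense_subgraph R (Leaf :: extend (tall k) 3) (fun T => x ^+ leaves T)
  (late k 3) x (1 - x - s)) => //.
- by rewrite /= VL.
- by move=> T; rewrite exprn_ge0.
- by rewrite big_cons expr1.
- exact: mem_head.
- exact: Node_family.
- by move=> A B; rewrite exprD.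
- exact: Leaf_late.
- exact: Node_late.
- by lra.
have : (1 / 4 * (235%:R / 1000%:R)) ^+ 2 <= (x * (1 - x - s)) ^+ 2.
  have e0 : 0 <= 1 - x - s by lra.
  by apply: lerXn2r; rewrite ?nnegrE ?mulr_ge0 //; try apply: ler_pM; lra.
lra.
Qed.

(** * Numerical bounds *)

Lemma sqrt_between (R : rcfType) (a b y : R) :
  0 <= a -> 0 <= b -> a ^+ 2 <= y <= b ^+ 2 -> a <= Num.sqrt y <= b.
Proof.
move=> a0 b0 /andP[ay yb].
by rewrite -[a]ger0_norm // -[b]ger0_norm // -!sqrtr_sqr !ler_wsqrtr.
Qed.

Lemma between_add_ratio (R : realFieldType) (c n e lo hi : R) :
  0 < e -> (lo - c) * e < n -> n < (hi - c) * e -> lo < c + n / e < hi.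
Proof.
move=> e0 lo_n n_hi; apply/andP; split.
  by rewrite addrC -ltrBlDr ltr_pdivlMr.
by rewrite addrC -ltrBrDr ltr_pdivrMr.
Qed.

Lemma Dplus_bounds (R : realType) :
  35007452936557%:R / 10 ^+ 13 < Dplus R < 35007452936559%:R / 10 ^+ 13.
Proof.
rewrite /Dplus /omega /rho /q3 /q2 /p0 /jconst.
set s := Num.sqrt 3; set t := Num.sqrt (2 * s - 1).
have /andP[s_lo s_hi] : 1732050807568877293%:R / 10 ^+ 18 <= s <=
    1732050807568877294%:R / 10 ^+ 18.
  by apply: sqrt_between; lra.
have /andP[t_lo t_hi] : 1569745716712663810%:R / 10 ^+ 18 <= t <=
    1569745716712663815%:R / 10 ^+ 18.
  by apply: sqrt_between; lra.
have s2 : s * s = 3 by rewrite -expr2 sqr_sqrtr.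
(* With s s = 3 and bounds on s t, the goal is linear in the monomials. *)
have st_lo : 1732050807568877293%:R / 10 ^+ 18 *
    (1569745716712663810%:R / 10 ^+ 18) <= s * t.
  by apply: ler_pM; lra.
have st_hi : s * t <= 1732050807568877294%:R / 10 ^+ 18 *
    (1569745716712663815%:R / 10 ^+ 18).
  by apply: ler_pM; lra.
clearbody s t.
by apply: between_add_ratio; lra.
Qed.

(** * The theorem *)

Theorem theorem1p1 (R : realType) :
  (* 3.50074529 *)
  (exists Y : {fset F},
     Y != fset0 /\ 350074529%:R / 10 ^+ 8 < dens R F_gens Y) /\
  Dplus R <= dens_graph R F_gens /\
  (* 3.5007452936557 and 3.5007452936559 *)
  35007452936557%:R / 10 ^+ 13 < Dplus R < 35007452936559%:R / 10 ^+ 13 /\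
  (* 0.49925471 *)
  edge_isoperimetric R F_gens < 49925471%:R / 10 ^+ 8.
Proof.
have [Y Y0 lab] := dense_F R.
have Ypos : 0 < #|` Y|%:R :> R by rewrite ltr0n cardfs_gt0.
have Ydens : 3500746%:R / 10 ^+ 6 < dens R F_gens Y.
  rewrite /dens ltr_pdivlMr //.
  have : (labelled_edges F_gens Y)%:R <= #|` edges_in F_gens Y|%:R :> R.
    rewrite ler_nat; apply: labelled_edges_le.
      exact: F_gens_neq1.
    exact: F_gens_mul_neq1.
  lra.
have Ybnd : #|` edge_boundary F_gens Y|%:R / #|` Y|%:R <
    49925471%:R / 10 ^+ 8 :> R.
  rewrite ltr_pdivrMr //; have := edge_boundary_le F_gens Y.
  have -> : #|` F_gens| = 2%N by rewrite cardfs2 F_gen01.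
  rewrite -(ler_nat R) natrD !natrM.
  lra.
split; first by exists Y; split=> //; lra.
have Dbnd := Dplus_bounds R; split; last split=> //.
  apply: (@le_trans _ _ (dens R F_gens Y)).
    by case/andP: Dbnd => _; lra.
  by apply: ub_le_sup; [have [] := has_sup_dens R F_gens | exists Y].
apply: le_lt_trans Ybnd; apply: ge_inf; last by exists Y.
by have [] := has_inf_edge_isoperimetric R F_gens.
Qed.
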